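(* Let $\beta\ge 1$. Assume that there is $u^\dagger\in\mathrm{dom}(J)$ with $Au^\dagger=f$ and that there is $q\in\mathcal H$ with $A^*q\in\partial J(u^\dagger)$. Let $$s_*:=\inf\{\|q\|_{\mathcal H}: q\in\mathcal H,\ A^*q\in\partial J(u)\text{ for some }u\in\mathrm{dom}(J)\text{ with }Au=f\},$$ $$J_{\min}:=\min\{J(u):u\in\mathcal X,\ Au=f\},\qquad t_*:=\frac{J_{\min}^{1-\beta}}{s_*}.$$ Then, for $t\ge 0$, there is a minimizer $u_t$ of $E_t^{1,\beta}(\cdot;f)$ fulfilling $Au_t=f$ if and only if $t\le t_*$.
   Context: Setting: $\mathcal X$ is the (real) Banach space dual of a separable Banach space $\mathcal Y$; $\mathcal H$ is a real Hilbert space; $A:\mathcal X\to\mathcal H$ is bounded and linear, with adjoint $A^*:\mathcal H\to\mathcal X^*$, $\langle A^*q,u\rangle=\langle q,Au\rangle$. $J:\mathcal X\to[0,\infty]$ is convex, proper, weak$^*$ lower semi-continuous and absolutely one-homogeneous ($J(cu)=|c|J(u)$). $\mathcal N(J)=\{u:J(u)=0\}$, $\mathrm{dom}(J)=\{u:J(u)<\infty\}$, and $\partial J(u)=\{p\in\mathcal X^*: J(u)+\langle p,v-u\rangle\le J(v)\ \forall v\in\mathcal X\}$. The datum $f\in\mathcal H$ is such that any $u\in\mathcal X$ with $Au=f$ satisfies $J(u)\ne 0$. For $\alpha,\beta\ge1$, $t\ge0$: $E_t^{\alpha,\beta}(u;f)=\frac1\alpha\|Au-f\|_{\mathcal H}^\alpha+\frac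 t\beta J(u)^\beta$ for $u\in\mathcal X$ (with value $+\infty$ if $J(u)=\infty$). Standing assumptions: (1) $u\mapsto\|Au\|_{\mathcal H}$ is a norm on $\mathcal N(J)$ equivalent to the restriction of $\|\cdot\|_{\mathcal X}$. (2) There is $C>0$ with $\|u-\mathcal P^A(Au)\|_{\mathcal X}\le C J(u)$ for all $u\in\mathcal X$, where $\mathcal P^A(g)$ denotes the (unique) minimizer of $\|Au-g\|_{\mathcal H}$ over $u\in\mathcal N(J)$, $g\in\mathcal H$. (3) $A$ is weak$^*$-to-weak continuous: $u_k\rightharpoonup^* u$ in $\mathcal X$ implies $Au_k\rightharpoonup Au$ in $\mathcal H$. Under the hypotheses on $f$, one has $0<s_*<\infty$ and $J_{\min}>0$. *)

(* Defs.v *)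
From HB Require Import structures.
From mathcomp Require Import all_boot all_order all_algebra.
From mathcomp Require Import sesquilinear.
From mathcomp Require Import all_classical all_reals all_analysis.

Set Implicit Arguments.
Unset Strict Implicit.
Unset Printing Implicit Defensive.

Import Order.TTheory GRing.Theory Num.Theory.
Import numFieldNormedType.Exports.

Local Open Scope classical_set_scope.
Local Open Scope ring_scope.

Definition separable (T : topologicalType) : Prop :=
  exists D : set T, countable D /\ dense D.

Definition continuous_dual (R : realType) (V : normedModType R) :
    set (V -> R) :=
  [set p : V -> R | scalar p /\ continuous p].

Definition dual_norm (R : realType) (V : normedModType R) (p : V -> R) : R :=
  sup [set `|p y| | y in [set y : V | `|y| <= 1]].

(* X is the Banach space dual of Y: the pairing identifies X, linearly and
   isometrically, with the space of continuous linear functionals on Y. *)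
Record is_dual_of (R : realType) (Y X : normedModType R)
    (pairing : X -> Y -> R) : Prop := IsDualOf {
  dual_linear : forall y, scalar (pairing ^~ y);
  dual_functional : forall x, continuous_dual (pairing x);
  dual_surjective : forall p, continuous_dual p -> exists x, pairing x = p;
  dual_isometric : forall x, `|x| = dual_norm (pairing x) }.

Definition weak_star (R : realType) (Y X : normedModType R)
    (pairing : X -> Y -> R) : topologicalType :=
  initial_topology (pairing : X -> {ptws Y -> R}).

Definition weak_star_cvg (R : realType) (Y X : normedModType R)
    (pairing : X -> Y -> R) (u : nat -> X) (l : X) : Prop :=
  (u : nat -> weak_star pairing) @ \oo --> (l : weak_star pairing).

Definition weak_cvg (R : realType) (V : normedModType R)
    (u : nat -> V) (l : V) : Prop :=
  forall p, continuous_dual p -> p (u k) @[k --> \oo] --> p l.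

Definition weak_star_to_weak_continuous (R : realType)
    (Y X H : normedModType R) (pairing : X -> Y -> R) (A : X -> H) : Prop :=
  forall (u : nat -> X) (l : X),
    weak_star_cvg pairing u l -> weak_cvg (A \o u) (A l).

(* Together with the completeness of H, this makes H a real Hilbert space
   with inner product ip. *)
Definition inner_product_norm (R : realType) (H : normedModType R)
    (ip : {dot H for idfun}) : Prop :=
  forall h : H, `|h| ^+ 2 = ip h h.

Section Functional.
Context {R : realType} {X : normedModType R}.
Implicit Types (J : X -> \bar R) (u v : X).
Local Open Scope ereal_scope.

Definition domain J : set X := [set u | J u < +oo].

Definition null_set J : set X := [set u | J u = 0].

Definition nonnegative_functional J : Prop := forall u, 0 <= J u.

Definition proper_functional J : Prop := domain J !=set0.

(* In \bar R one has 0 * +oo = 0; for a proper_functional J this leaves the meaning of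
   the next two definitions unchanged. *)
Definition convex_functional J : Prop :=
  forall u v (t : R), (0 <= t <= 1)%R ->
    J (t *: u + (1 - t) *: v)%R <= t%:E * J u + (1 - t)%:E * J v.

Definition abs_one_homogeneous J : Prop :=
  forall (c : R) u, J (c *: u)%R = `|c|%:E * J u.

Definition weak_star_lsc (Y : normedModType R) (pairing : X -> Y -> R) J :
    Prop :=
  lower_semicontinuous (J : weak_star pairing -> \bar R).

Definition subdifferential J u : set (X -> R) :=
  [set p : X -> R | continuous_dual p /\
           forall v, J u + (p (v - u)%R)%:E <= J v].

End Functional.

Definition is_norm_on (R : realType) (X : normedModType R) (N : set X)
    (g : X -> R) : Prop :=
  [/\ forall u, N u -> 0 <= g u,
      forall u, N u -> g u = 0 -> u = 0,
      forall (c : R) u, N u -> g (c *: u) = `|c| * g u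
    & forall u v, N u -> N v -> g (u + v) <= g u + g v].

Definition equivalent_norms_on (R : realType) (X : normedModType R)
    (N : set X) (g1 g2 : X -> R) : Prop :=
  exists c C : R, [/\ 0 < c, 0 < C &
    forall u, N u -> c * g2 u <= g1 u <= C * g2 u].

Section Problem.
Context {R : realType} {X H : normedModType R}.
Variables (ip : {dot H for idfun}) (A : {linear X -> H}) (J : X -> \bar R).

Definition adjoint (q : H) : X -> R := fun u => ip q (A u).

Definition is_projection (g : H) (u : X) : Prop :=
  null_set J u /\ forall v, null_set J v -> `|A u - g| <= `|A v - g|.

(* The minimizer of |A u - g| over the null set of J; its default value 0 is
   taken only when there is no minimizer, which cannot happen when J is
   weak* lower semicontinuous and norm_equivalence below holds. *)
Definition projection (g : H) : X := xget 0 [set u | is_projection g u].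

Definition norm_equivalence : Prop :=
  is_norm_on (null_set J) (fun u => `|A u|) /\
  equivalent_norms_on (null_set J) (fun u => `|A u|) (fun u => `|u|).

Definition poincare_inequality : Prop :=
  exists2 C : R, 0 < C &
    forall u, (`|u - projection (A u)|%:E <= C%:E * J u)%E.

(* The case distinction makes the value +oo on the complement of the domain
   of J also for t = 0, where 0 * +oo = 0 would not. *)
Definition energy (alpha beta t : R) (f : H) (u : X) : \bar R :=
  if J u == +oo%E then +oo%E
  else (alpha^-1 * `|A u - f| `^ alpha + t / beta * fine (J u) `^ beta)%:E.

Definition is_minimizer (F : X -> \bar R) (u : X) : Prop :=
  forall v, (F u <= F v)%E.

Definition source_condition (f : H) (u : X) (q : H) : Prop :=
  [/\ domain J u, A u = f & subdifferential J u (adjoint q)].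

Definition s_star (f : H) : R :=
  inf [set `|q| | q in [set q | exists u, source_condition f u q]].

(* The infimum is attained under the source condition: see J_minE. *)
Definition J_min (f : H) : R :=
  fine (ereal_inf [set J u | u in [set u | A u = f]]).

Definition t_star (beta : R) (f : H) : R := J_min f `^ (1 - beta) / s_star f.

Lemma J_minE (f : H) (u : X) (q : H) : nonnegative_functional J ->
  source_condition f u q ->
  (J_min f)%:E = J u /\ forall v, A v = f -> (J u <= J v)%E.
Proof.
move=> J0 [Ju Au [_ Jq]].
have le v : A v = f -> (J u <= J v)%E.
  move=> Av; have := Jq v; rewrite /adjoint linearB/= Av Au subrr linear0r.
  by rewrite adde0.
have infE : ereal_inf [set J u | u in [set u | A u = f]] = J u.
  apply/eqP; rewrite eq_le; apply/andP; split.
    by apply: ereal_inf_lbound; exists u.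
  by apply: le_ereal_inf_tmp => _ [v Av <-]; exact: le.
split=> //; rewrite /J_min infE fineK// ge0_fin_numE//; exact: J0.
Qed.

End Problem.

(* Main.v *)
Require Import Defs.
From HB Require Import structures.
From mathcomp Require Import all_boot all_order all_algebra.
From mathcomp Require Import sesquilinear.
From mathcomp Require Import all_classical all_reals all_analysis.
From mathcomp Require Import ring lra.

Set Implicit Arguments.
Unset Strict Implicit.
Unset Printing Implicit Defensive.

Import Order.TTheory GRing.Theory Num.Theory.
Import numFieldNormedType.Exports.

Local Open Scope classical_set_scope.
Local Open Scope ring_scope.

(** Write m for the minimal value of J under the constraint A u = f, and let
    lambda = t * m `^ (beta - 1). At y = m the tangent of t / beta * y `^ beta
    has slope lambda, so near a point u with A u = f and J u = m the energy
    looks like `|A v - f| + lambda * J v. Both directions go through the linear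
    estimate

      lambda * (m - J v) <= `|A v - f|   for all v,                       (E)

    which turns out to be equivalent to minimality of u.

    - (E) implies minimality because y `^ beta lies above its tangent
      ([powR_tangent]). A source element q gives m - J v <= `|q| * `|A v - f|
      ([source_le]), and taking the infimum over q replaces `|q| by s_star; so
      lambda * s_star <= 1, that is t <= t_star, implies (E).

    - Minimality implies (E) by comparing u with the points of the segment from
      u to v and letting them tend to u ([minimizer_slope]).

    - For t > 0, (E) implies lambda * s_star <= 1 by duality: (E) says that the
      convex set of the pairs (A v - f, r - m) with J v <= r lies above the
      downward cone of slope 1 / lambda, and a Hilbert space contains a vector
      q of norm at most 1 / lambda whose linear functional separates the two
      ([convex_multiplier]). Separation from that set is exactly the
      subgradient inequality for q at u, so s_star <= `|q| <= 1 / lambda.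

    The separation theorem comes directly from completeness and the inner
    product: on the cone generated by the convex set, minimizing sequences of
    a + `|h| ^+ 2 / 2 are Cauchy in h by the parallelogram law, and the opposite
    of their limit is the required vector ([cone_multiplier]). *)

(** * Scalar inequalities *)

Lemma le0_of_small_multiples (R : realFieldType) (a c : R) :
  (forall s, 0 < s < 1 -> a <= s * c) -> a <= 0.
Proof.
move=> h; rewrite leNgt; apply/negP => a0.
have c2 : 2 * a <= c by have := h 2^-1 ltac:(lra); lra.
have c0 : 0 < c by lra.
have s1 : a / (2 * c) < 1 by rewrite ltr_pdivrMr; lra.
have s0 : 0 < a / (2 * c) by rewrite divr_gt0//; lra.
have := h (a / (2 * c)) ltac:(by rewrite s0).
rewrite (_ : a / (2 * c) * c = a / 2); last by field; lra.
lra.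
Qed.

(** This is Young's inequality for the product of x and m `^ (beta - 1), with
    conjugate exponents beta and beta / (beta - 1); only the affine case
    beta = 1 has to be treated apart. *)
Lemma powR_tangent (R : realType) (beta m x : R) :
  1 <= beta -> 0 <= m -> 0 <= x ->
  m `^ beta + beta * m `^ (beta - 1) * (x - m) <= x `^ beta.
Proof.
rewrite le_eqVlt => /predU1P[<- m0 x0|b1 m0 x0].
  by rewrite subrr powRr0 !powRr1//; lra.
have mE : m * m `^ (beta - 1) = m `^ beta by rewrite mulr_powRB1//; lra.
have := @conjugate_powR R x (m `^ (beta - 1)) beta (beta / (beta - 1)) x0
  (powR_ge0 _ _) ltac:(lra) ltac:(by rewrite divr_gt0//; lra) ltac:(by field; lra).
rewrite -powRrM (_ : (beta - 1) * _ = beta); last by field; lra.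
have -> : m `^ beta / (beta / (beta - 1)) = m `^ beta * (beta - 1) / beta.
  by field; lra.
rewrite -mulrDl ler_pdivlMr; last by lra.
rewrite -mE; nra.
Qed.

(** * Separation in a Hilbert space *)

Section hilbert.
Context {R : realType} {H : completeNormedModType R}.
Variables (ip : {dot H for idfun}) (ip_norm : inner_product_norm ip).
Implicit Types (x y h k q : H) (s a b : R).

Lemma ipC x y : ip x y = ip y x.
Proof. by rewrite hermC expr0 mul1r. Qed.

Lemma sqr_normD x y : `|x + y| ^+ 2 = `|x| ^+ 2 + 2 * ip x y + `|y| ^+ 2.
Proof. by rewrite !ip_norm linearDl/= !linearDr/= (ipC y x); ring. Qed.

Lemma ipNl x y : ip (- x) y = - ip x y. Proof. by rewrite linearNl. Qed.
Lemma ipZl s x y : ip (s *: x) y = s * ip x y. Proof. by rewrite linearZl_LR. Qed.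
Lemma ipZr s x y : ip x (s *: y) = s * ip x y. Proof. by rewrite ipC ipZl ipC. Qed.

Lemma ipNr x y : ip x (- y) = - ip x y. Proof. by rewrite linearNr. Qed.

Lemma parallelogram x y :
  `|x + y| ^+ 2 + `|x - y| ^+ 2 = 2 * (`|x| ^+ 2 + `|y| ^+ 2).
Proof. by rewrite !sqr_normD ipNr normrN; ring. Qed.

Lemma cauchy_schwarz x y : ip x y <= `|x| * `|y|.
Proof.
have [->|x0] := eqVneq x 0; first by rewrite linear0l normr0 mul0r.
have [->|y0] := eqVneq y 0; first by rewrite linear0r normr0 mulr0.
have nx : 0 < `|x| by rewrite normr_gt0.
have ny : 0 < `|y| by rewrite normr_gt0.
have := sqr_ge0 `| `|y| *: x - `|x| *: y|.
rewrite sqr_normD normrN !normrZ !normr_id ipNr ipZl ipZr => h.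
have : 0 <= (2 * (`|x| * `|y|)) * (`|x| * `|y| - ip x y) by lra.
by rewrite pmulr_rge0 ?subr_ge0//; rewrite !mulr_gt0.
Qed.

Section cone.
Variables (C : H -> R -> Prop) (K : R).
Hypothesis CD : forall h k a b, C h a -> C k b -> C (h + k) (a + b).
Hypothesis CZ : forall s h a, 0 < s -> C h a -> C (s *: h) (s * a).
Hypothesis C_nonempty : exists h a, C h a.
Hypothesis C_ge : forall h a, C h a -> - (K * `|h|) <= a.
Hypothesis K0 : 0 <= K.

Let values := [set x | exists h a, C h a /\ x = a + `|h| ^+ 2 / 2].
Let I := inf values.

Let values_lbound : has_lbound values.
Proof.
exists (- (K ^+ 2 / 2)) => _ [k [b [/C_ge Cb ->]]].
have := sqr_ge0 (`|k| - K); lra.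
Qed.

Let I_le h a : C h a -> I <= a + `|h| ^+ 2 / 2.
Proof. by move=> Ca; apply: (ge_inf values_lbound); exists h, a. Qed.

Let minimizing e : 0 < e -> exists h a, C h a /\ a + `|h| ^+ 2 / 2 < I + e.
Proof.
move=> e0; have [|_ [h [a [Ca ->]]] lt] := @inf_adherent R values e e0.
  by split=> //; have [h [a Ca]] := C_nonempty; exists (a + `|h| ^+ 2 / 2), h, a.
by exists h, a.
Qed.

(** Midpoints stay in C, so the strong convexity of the squared norm makes the
    first components of a minimizing sequence Cauchy. Their limit l may come
    from no point of C, hence the formulation by almost minimizers near l. *)
Let minimizing_limit : exists l, forall e, 0 < e ->
  exists h a, [/\ C h a, a + `|h| ^+ 2 / 2 < I + e & `|h - l| < e].
Proof.
have /choice[h /choice[a ha]] :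
    forall n : nat, exists h a, C h a /\ a + `|h| ^+ 2 / 2 < I + n.+1%:R^-1.
  by move=> n; exact: minimizing.
have dist i j : `|h i - h j| ^+ 2 <= 4 * (i.+1%:R^-1 + j.+1%:R^-1).
  have [Ci Fi] := ha i; have [Cj Fj] := ha j.
  have := I_le (CZ (s := 2^-1) ltac:(lra) (CD Ci Cj)).
  rewrite normrZ exprMn gtr0_norm; last by lra.
  rewrite (_ : 2^-1 ^+ 2 = 1 / 4 :> R); last by field.
  have := parallelogram (h i) (h j); move: Fi Fj.
  by move: (i.+1%:R^-1 : R) (j.+1%:R^-1 : R) => ei ej; lra.
have ch : cauchy (h @ \oo).
  apply: cauchy_exP => e e0.
  have e80 : 0 < e ^+ 2 / 8 by rewrite divr_gt0// exprn_gt0.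
  have [N _ Ne] := near_infty_natSinv_lt (PosNum e80).
  exists (h N); exists N => // n /Ne/= Nn; rewrite -ball_normE /=.
  rewrite -(ltr_pXn2r (n := 2))// ?nnegrE ?normr_ge0 ?ltW//.
  apply: le_lt_trans (dist _ _) _.
  have /= := Ne _ (leqnn N); move: Nn.
  by move: (n.+1%:R^-1 : R) (N.+1%:R^-1 : R) => en eN; lra.
have /cvg_ex[l /cvgrPdist_lt hl] : cvg (h @ \oo) by apply/cauchy_cvgP.
exists l => e e0.
near \oo => n.
exists (h n), (a n); have [Cn Fn] := ha n; split => //.
- apply: lt_le_trans Fn _; rewrite lerD2l ltW//.
  by near: n; exact: (near_infty_natSinv_lt (PosNum e0)).
- by rewrite distrC; near: n; exact: hl.
Unshelve. all: by end_near.
Qed.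

(** The multiplier q = - l is read off from the first order conditions at the
    almost minimizers (h, a): moving by s *: (k, b) inside C gives
    0 <= b + ip l k up to O(s), and shrinking (h, a) by the factor 1 - s gives
    `|l| ^+ 2 <= K * `|l| up to O(s). *)
Lemma cone_multiplier :
  exists q, `|q| <= K /\ forall h a, C h a -> ip q h <= a.
Proof.
have [l lP] := minimizing_limit.
exists (- l); split.
  rewrite normrN; have [->|l0] := eqVneq l 0; first by rewrite normr0.
  rewrite -(ler_pM2l (x := `|l|)) ?normr_gt0// -expr2 -subr_le0.
  set c := (`|l| + 1) ^+ 2 / 2 + 2 * `|l| + 2 + K.
  apply: (@le0_of_small_multiples _ _ c) => s /andP[s0 s1].
  (* An error s ^+ 2 in the minimization is negligible at the first order in s. *)
  have s20 : 0 < s ^+ 2 by rewrite exprn_gt0.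
  have s2s : s ^+ 2 <= s by rewrite expr2 ger_pMl// ltW.
  have [h [a [Ca Fa hl]]] := lP _ s20.
  have := I_le (CZ (s := 1 - s) ltac:(lra) Ca).
  rewrite normrZ exprMn gtr0_norm; last by lra.
  have := C_ge Ca.
  have := lerB_dist h l; have := lerB_dist l h; rewrite distrC /c.
  have := normr_ge0 l; have := normr_ge0 h.
  move: (`|h|) (`|l|) (`|h - l|) hl Fa => y x d hl Fa y0 x0 xy yx ay Ia.
  have yy : s * (y ^+ 2 - K * y) <= s * (s * (y ^+ 2 / 2 + 1)) by nra.
  rewrite ler_pM2l// in yy.
  have dx : x - y <= s by lra.
  have dy : y - x <= s by lra.
  have y1 : y <= x + 1 by lra.
  have A1 : x ^+ 2 - y ^+ 2 <= s * (x + y) by rewrite subr_sqr ler_wpM2r//; lra.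
  have A2 : K * (y - x) <= s * K by rewrite mulrC ler_wpM2r.
  have A3 : y ^+ 2 <= (x + 1) ^+ 2 by rewrite ler_pXn2r// nnegrE//; lra.
  have A4 : s * y ^+ 2 <= s * (x + 1) ^+ 2 by rewrite ler_pM2l.
  have A5 : s * y <= s * (x + 1) by rewrite ler_pM2l.
  lra.
move=> k b Cb; rewrite -subr_le0.
apply: (@le0_of_small_multiples _ _ (`|k| ^+ 2 / 2 + 1 + `|k|)) => s /andP[s0 s1].
have s20 : 0 < s ^+ 2 by rewrite exprn_gt0.
have s2s : s ^+ 2 <= s by rewrite expr2 ger_pMl// ltW.
have [h [a [Ca Fa hl]]] := lP _ s20.
have := I_le (CD Ca (CZ s0 Cb)).
rewrite sqr_normD ipZr normrZ exprMn gtr0_norm// ipNl.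
have : ip (h - l) k <= s * `|k|.
  by rewrite (le_trans (cauchy_schwarz _ _))// ler_wpM2r//; lra.
rewrite linearBl/= -(ler_pM2l s0) => A1 A2.
rewrite -(ler_pM2l s0); nra.
Qed.

End cone.
End hilbert.

(** The hypothesis and the conclusion both pass from D to the cone that it
    generates, since they are positively homogeneous. *)
Lemma convex_multiplier (R : realType) (H : completeNormedModType R)
    (ip : {dot H for idfun}) (D : H -> R -> Prop) (K : R) :
  inner_product_norm ip ->
  (forall s h k a b, 0 < s < 1 -> D h a -> D k b ->
    D (s *: h + (1 - s) *: k) (s * a + (1 - s) * b)) ->
  (exists h a, D h a) ->
  (forall h a, D h a -> - (K * `|h|) <= a) ->
  0 <= K ->
  exists q, `|q| <= K /\ forall h a, D h a -> ip q h <= a.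
Proof.
move=> ip_norm D_convex [h0 [a0 Da0]] D_ge K0.
pose C h a := exists s k b, [/\ 0 < s, D k b, h = s *: k & a = s * b].
have [||||//|q [qK qP]] := @cone_multiplier R H ip ip_norm C K.
- move=> _ _ _ _ [s [h [a [s0 Da -> ->]]]] [r [k [b [r0 Db -> ->]]]].
  have sr0 : 0 < s + r by rewrite addr_gt0.
  have [l [l01 lE l'E]] : exists l, [/\ 0 < l < 1, (s + r) * l = s &
      (s + r) * (1 - l) = r].
    exists (s / (s + r)); rewrite divr_gt0//= ltr_pdivrMr// mul1r ltrDl.
    by split => //; field; rewrite gt_eqF.
  exists (s + r), (l *: h + (1 - l) *: k), (l * a + (1 - l) * b); split => //.
  + exact: D_convex.
  + by rewrite scalerDr !scalerA lE l'E.
  + by rewrite mulrDr !mulrA lE l'E.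
- move=> s _ _ s0 [r [k [b [r0 Db -> ->]]]].
  by exists (s * r), k, b; split; rewrite ?mulr_gt0// ?scalerA ?mulrA.
- by exists h0, a0, 1, h0, a0; rewrite scale1r mul1r.
- move=> _ _ [s [k [b [s0 /D_ge Db -> ->]]]].
  by rewrite normrZ gtr0_norm// mulrCA -mulrN ler_pM2l.
exists q; split=> // h a Da; apply: qP.
by exists 1, h, a; rewrite scale1r mul1r.
Qed.

(** * Source elements and minimizers *)

Section problem.
Context {R : realType} {X H : completeNormedModType R}.
Variables (ip : {dot H for idfun}) (A : {linear X -> H}) (J : X -> \bar R).
Variables (f : H).
Hypothesis ip_norm : inner_product_norm ip.
Hypothesis J_ge0 : nonnegative_functional J.
Hypothesis J_convex : convex_functional J.

Lemma adjoint_continuous_dual q :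
  bounded_near A (nbhs (0 : X)) -> continuous_dual (adjoint ip A q).
Proof.
move=> /linear_bounded_continuous cA; split.
  by move=> a u v; rewrite /adjoint linearP/= linearDr/= ipZr.
move=> u; apply/cvgrPdist_lt => e e0.
have q1 : 0 < `|q| + 1 by rewrite ltr_wpDl.
have /cvgrPdist_lt/(_ (e / (`|q| + 1)) ltac:(by rewrite divr_gt0)) := cA u.
apply: filterS => v; rewrite ltr_pdivlMr// => Auv.
apply: le_lt_trans Auv; rewrite /adjoint -linearBr/=.
have leq q' : `|q'| = `|q| -> ip q' (A u - A v) <= `|A u - A v| * (`|q| + 1).
  move=> q'q; apply: le_trans (cauchy_schwarz ip_norm _ _) _.
  by rewrite q'q mulrC ler_wpM2l// lerDl.
by rewrite ler_norml lerNl -ipNl !leq// normrN.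
Qed.

Lemma source_le u q v x : source_condition ip A J f u q -> J v = x%:E ->
  fine (J u) - x <= `|q| * `|A v - f|.
Proof.
move=> [Ju Au [_ Jq]] Jv.
have Juf : J u \is a fin_num by rewrite ge0_fin_numE.
have := Jq v; rewrite Jv -[J u]fineK// /adjoint linearB/= Au -EFinD lee_fin => h.
have := cauchy_schwarz ip_norm (- q) (A v - f).
rewrite normrN ipNl; lra.
Qed.

Lemma energy_fin beta t u x : J u = x%:E ->
  energy A J 1 beta t f u = (`|A u - f| + t / beta * x `^ beta)%:E.
Proof. by move=> Ju; rewrite /energy Ju/= invr1 mul1r powRr1. Qed.

(** On the segment from u to v, convexity bounds J by m * c with c = 1 - s * e
    and e = (m - x) / m. The tangent at m * c, not the one at m, bounds the
    resulting decrease of y `^ beta from below; its slope involves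
    c `^ (beta - 1), which is at least c `^ beta >= 1 - beta * (s * e), hence
    tends to 1 with s. *)
Lemma minimizer_slope (beta t : R) u (m : R) : 1 <= beta -> 0 <= t -> 0 < m ->
  J u = m%:E -> A u = f -> is_minimizer (energy A J 1 beta t f) u ->
  forall v x, (J v <= x%:E)%E ->
    t * m `^ (beta - 1) * (m - x) <= `|A v - f|.
Proof.
move=> b1 t0 m0 Ju Au umin v x Jv.
have x0 : 0 <= x by rewrite -lee_fin (le_trans (J_ge0 v)).
have M0 : 0 <= m `^ (beta - 1) by exact: powR_ge0.
have [xm|xm] := leP m x.
  by apply: le_trans (normr_ge0 _); rewrite mulr_ge0_le0 ?mulr_ge0// subr_le0.
rewrite -subr_le0.
apply: (@le0_of_small_multiples _ _
  (t * m `^ (beta - 1) * (m - x) * (beta * ((m - x) / m)))) => s /andP[s0 s1].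
set c := 1 - s * ((m - x) / m).
have e01 : 0 < (m - x) / m <= 1.
  by rewrite divr_gt0 ?subr_gt0//= ler_pdivrMr//; lra.
have c0 : 0 < c by rewrite /c; nra.
have c1 : c <= 1 by rewrite /c; nra.
pose w := s *: v + (1 - s) *: u.
have Aw : A w - f = s *: (A v - f).
  by rewrite linearD/= !linearZ/= Au scalerBl scale1r scalerBr addrA addrAC addrK.
have zE : s * x + (1 - s) * m = m * c by rewrite /c; field; lra.
have Jw : (J w <= (m * c)%:E)%E.
  apply: le_trans (J_convex _ _ _) _; first by rewrite !ltW.
  rewrite Ju -zE [leRHS]EFinD !EFinM leeD//.
  by apply: lee_wpmul2l => //; rewrite lee_fin ltW.
have Jwf : J w \is a fin_num by rewrite ge0_fin_numE// (le_lt_trans Jw)// ltry.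
have := umin w.
rewrite (energy_fin _ _ Ju) (energy_fin _ _ (esym (fineK Jwf))) lee_fin.
rewrite Au subrr normr0 add0r Aw normrZ gtr0_norm// => ineq.
have jw0 : 0 <= fine (J w) by apply: fine_ge0.
have jwz : fine (J w) <= m * c by rewrite -lee_fin fineK.
have mc0 : 0 < m * c by rewrite mulr_gt0.
have jwb : fine (J w) `^ beta <= (m * c) `^ beta.
  by apply: ge0_ler_powR => //; rewrite ?nnegrE ?ltW//; lra.
have tan := powR_tangent b1 (ltW mc0) (ltW m0).
have cb : 1 - beta * (s * ((m - x) / m)) <= c `^ (beta - 1).
  have := powR_tangent b1 ler01 (ltW c0); rewrite !powR1 {1}/c => tc.
  have : c * c `^ (beta - 1) <= c `^ (beta - 1).
    by rewrite ger_pMl// powR_gt0.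
  rewrite mulr_powRB1 ?(ltW c0)//; last by lra.
  move: tc; move: (c `^ beta) (c `^ (beta - 1)) (s * _) => B B1 e. lra.
have tb : t / beta * m `^ beta <=
    s * `|A v - f| + t / beta * (m * c) `^ beta.
  apply: le_trans ineq _; rewrite lerD2l ler_wpM2l// divr_ge0//; lra.
have step : t * (m * c) `^ (beta - 1) * (s * (m - x)) <= s * `|A v - f|.
  have -> : s * (m - x) = m - m * c by rewrite -zE; ring.
  have tb0 : 0 <= t / beta by rewrite divr_ge0//; lra.
  have := ler_wpM2l tb0 tan.
  have -> : t * (m * c) `^ (beta - 1) * (m - m * c) =
    t / beta * (beta * (m * c) `^ (beta - 1) * (m - m * c)) by field; lra.
  lra.
rewrite mulrCA ler_pM2l// (powRM _ (ltW m0) (ltW c0)) in step.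
have a0 : 0 <= t * m `^ (beta - 1) * (m - x) by rewrite !mulr_ge0// subr_ge0 ltW.
have := ler_wpM2l a0 cb; move: step.
by move: (c `^ _) (m `^ _) ((m - x) / m) (`|A v - f|) => C M e r; lra.
Qed.

(** The subgradient inequality at u asks the functional of q to lie below the
    convex set of the pairs (A v - f, r - m) with J v <= r, while the assumed
    slope bound says that this set lies above the cone of slope lambda^-1. *)
Lemma exists_source_element (lambda : R) u (m : R) : bounded_near A (nbhs (0 : X)) ->
  0 < lambda -> J u = m%:E -> A u = f ->
  (forall v x, (J v <= x%:E)%E -> lambda * (m - x) <= `|A v - f|) ->
  exists q, source_condition ip A J f u q /\ `|q| <= lambda^-1.
Proof.
move=> A_bounded l0 Ju Au slope.
pose D k b := exists2 v, A v - f = k & (J v <= (b + m)%:E)%E.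
have [||||q [qK qP]] := @convex_multiplier R H ip D lambda^-1 ip_norm.
- move=> r _ _ a b /andP[r0 r1] [v <- Jv] [v' <- Jv'].
  exists (r *: v + (1 - r) *: v').
    rewrite linearD/= !linearZ/= !scalerBr addrACA -opprD -scalerDl.
    by rewrite (addrC r) subrK scale1r.
  have r01 : 0 <= r <= 1 by rewrite !ltW.
  apply: le_trans (J_convex v v' r01) _.
  have -> : r * a + (1 - r) * b + m = r * (a + m) + (1 - r) * (b + m) by ring.
  rewrite [leRHS]EFinD !EFinM; apply: leeD; apply: lee_wpmul2l => //.
    by rewrite lee_fin ltW.
  by rewrite lee_fin subr_ge0 ltW.
- by exists (A u - f), 0, u; rewrite // add0r Ju.
- move=> _ b [v <- /slope]; rewrite opprD addrCA subrr addr0.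
  by rewrite lerNl ler_pdivlMl.
- by rewrite invr_ge0 ltW.
exists q; split=> //; split=> //; first by rewrite /domain/= Ju ltry.
split; first exact: adjoint_continuous_dual.
move=> v; have [->|Jv] := eqVneq (J v) +oo%E; first by rewrite leey.
have Jvf : J v \is a fin_num by rewrite ge0_fin_numE// ltey.
rewrite Ju -(fineK Jvf) -EFinD lee_fin /adjoint linearB/= Au.
have := qP (A v - f) (fine (J v) - m).
by rewrite -lerBrDl; apply; exists v => //; rewrite subrK fineK.
Qed.

End problem.

(** * The threshold for exact reconstruction *)

Theorem theorem2p10 (R : realType) (Y X H : completeNormedModType R)
    (pairing : X -> Y -> R) (ip : {dot H for idfun})
    (A : {linear X -> H}) (J : X -> \bar R) (f : H) (beta : R)
    (Y_separable : separable Y)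
    (X_dual : is_dual_of pairing)
    (H_hilbert : inner_product_norm ip)
    (A_bounded : bounded_near A (nbhs (0 : X)))
    (J_ge0 : nonnegative_functional J)
    (J_convex : convex_functional J)
    (J_proper : proper_functional J)
    (J_lsc : weak_star_lsc pairing J)
    (J_homogeneous : abs_one_homogeneous J)
    (f_nontrivial : forall u, A u = f -> J u <> 0%E)
    (A_norm : norm_equivalence A J)
    (J_poincare : poincare_inequality A J)
    (A_continuous : weak_star_to_weak_continuous pairing A)
    (beta_ge1 : 1 <= beta)
    (f_source : exists u q, source_condition ip A J f u q) :
  forall t : R, 0 <= t ->
    (exists u, is_minimizer (energy A J 1 beta t f) u /\ A u = f) <->
    t <= t_star ip A J beta f.
Proof.
move=> t t0; have [u [q0 uq0]] := f_source.
have [mE u_min] := J_minE J_ge0 uq0.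
have [Ju Au _] := uq0.
rewrite /t_star; set m := J_min A J f in mE *; set s := s_star ip A J f.
have m0 : 0 < m.
  rewrite -lte_fin mE lt_neqAle J_ge0 andbT eq_sym.
  by apply/eqP; exact: f_nontrivial.
have f0 : 0 < `|f|.
  rewrite normr_gt0; apply/eqP => f0; apply: (f_nontrivial 0).
    by rewrite linear0 f0.
  by rewrite -(scale0r u) J_homogeneous normr0 mul0e.
have source_m q v x u' : source_condition ip A J f u' q -> J v = x%:E ->
    m - x <= `|q| * `|A v - f|.
  move=> u'q Jv; have [mE' _] := J_minE J_ge0 u'q.
  by have := source_le H_hilbert J_ge0 u'q Jv; rewrite -mE'.
clearbody m.
have J00 : J 0 = 0%:E by rewrite -(scale0r u) J_homogeneous normr0 mul0e.
have s_nonempty :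
    [set `|q| | q in [set q | exists u, source_condition ip A J f u q]] !=set0.
  by exists `|q0|, q0 => //; exists u.
have s0 : 0 < s.
  apply: (@lt_le_trans _ _ (m / `|f|)); first by rewrite divr_gt0.
  apply: lb_le_inf => // _ [q [u' u'q] <-].
  have := source_m _ _ _ _ u'q J00.
  by rewrite subr0 linear0 sub0r normrN ler_pdivrMr.
have M0 : 0 < m `^ (beta - 1) by exact: powR_gt0.
have -> : m `^ (1 - beta) = (m `^ (beta - 1))^-1 by rewrite -powRN opprB.
rewrite ler_pdivlMr// -(ler_pM2l M0) divff ?gt_eqF//.
split=> [[w [w_min Aw]]|ts].
  (* Replacing J w by the minimal value J u cannot increase the energy. *)
  have {w w_min Aw} u_minimizer : is_minimizer (energy A J 1 beta t f) u.
    move=> v; apply: le_trans (w_min v).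
    rewrite (energy_fin _ _ _ _ (esym mE)) Au subrr normr0 add0r.
    have [Jw|Jw] := eqVneq (J w) +oo%E; first by rewrite /energy Jw eqxx/= leey.
    have Jwf : J w \is a fin_num by rewrite ge0_fin_numE// ltey.
    rewrite (energy_fin _ _ _ _ (esym (fineK Jwf))) Aw subrr normr0 add0r.
    rewrite lee_fin.
    apply: ler_wpM2l; first by rewrite divr_ge0//; lra.
    apply: ge0_ler_powR; rewrite ?nnegrE; [lra|exact: ltW|exact: fine_ge0|].
    by rewrite -lee_fin fineK// mE u_min.
  have [->|tn0] := eqVneq t 0; first by rewrite mul0r mulr0.
  have tp : 0 < t by rewrite lt_neqAle eq_sym tn0.
  have slope :=
    minimizer_slope J_ge0 J_convex beta_ge1 t0 m0 (esym mE) Au u_minimizer.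
  have l0 : 0 < t * m `^ (beta - 1) by rewrite mulr_gt0.
  have [q [uq qK]] :=
    exists_source_element H_hilbert J_ge0 J_convex A_bounded l0 (esym mE) Au slope.
  have sK : s <= (t * m `^ (beta - 1))^-1.
    apply: le_trans qK; apply: ge_inf; last by exists q => //; exists u.
    by exists 0 => _ [? _ <-].
  by rewrite mulrA (mulrC _ t) -ler_pdivlMl// mulr1.
exists u; split=> // v.
have [Jv|Jv] := eqVneq (J v) +oo%E; first by rewrite {2}/energy Jv eqxx/= leey.
have Jvf : J v \is a fin_num by rewrite ge0_fin_numE// ltey.
rewrite (energy_fin _ _ _ _ (esym mE)) Au subrr normr0 add0r.
rewrite (energy_fin _ _ _ _ (esym (fineK Jvf))) lee_fin.
set x := fine (J v); set r := `|A v - f|.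
have x0 : 0 <= x by apply: fine_ge0.
have r0 : 0 <= r by exact: normr_ge0.
have msr : m - x <= s * r.
  have [r00|rn0] := eqVneq r 0.
    by have := source_m _ _ _ _ uq0 (esym (fineK Jvf)); rewrite -/r r00 !mulr0.
  have rp : 0 < r by rewrite lt_neqAle eq_sym rn0.
  rewrite -ler_pdivrMr//; apply: lb_le_inf => // _ [q [u' u'q] <-].
  by rewrite ler_pdivrMr//; exact: source_m u'q (esym (fineK Jvf)).
have lr : t * m `^ (beta - 1) * (m - x) <= r.
  apply: (@le_trans _ _ (t * m `^ (beta - 1) * (s * r))).
    by rewrite ler_wpM2l// mulr_ge0// ltW.
  by rewrite mulrA ler_piMl//; lra.
have tb0 : 0 <= t / beta by rewrite divr_ge0//; lra.
have := ler_wpM2l tb0 (powR_tangent beta_ge1 (ltW m0) x0).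
have : t / beta * (beta * m `^ (beta - 1) * (x - m)) =
  t * m `^ (beta - 1) * (x - m) by field; lra.
lra.
Qed.
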